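(* Let $\mathbf{P}$ be a boldface projective pointclass, let $V$ be a Polish space, let $f:V\to V$ be a $\mathbf{P}$ function, and let $G=(V,E)$ be the graph generated by $f$, i.e. $E=\{(v,w)\in V\times V: v\neq w \wedge (f(v)=w\vee f(w)=v)\}$. Then either $\chi_{\mathbf{P}}(G)\in\{1,2,3\}$ or $\chi_{\mathbf{P}}(G)$ is infinite.
   Context: A boldface projective (Lusin) pointclass is one of $\mathbf{\Sigma}^1_m,\mathbf{\Pi}^1_m,\mathbf{\Delta}^1_m$ ($m\geq1$). A $\mathbf{P}$ function is a function that is $\mathbf{P}$-definable, i.e. preimages of Borel sets under it belong to $\mathbf{P}$. A $\mathbf{P}$ class $\kappa$-colouring of a graph with Polish vertex set is a map from the vertex set to a set of cardinality $\kappa$ giving adjacent vertices distinct values, each of whose colour classes is in $\mathbf{P}$; $\chi_{\mathbf{P}}(G)$ is the least $\kappa$ for which one exists. *)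

(* Defs.v *)
From mathcomp Require Import all_boot all_order all_algebra.
From mathcomp Require Import all_classical all_reals all_analysis.

Set Implicit Arguments.
Unset Strict Implicit.
Unset Printing Implicit Defensive.

Import Order.TTheory GRing.Theory Num.Theory.
Local Open Scope classical_set_scope.
Local Open Scope ring_scope.
Local Open Scope card_scope.

Definition separable (V : topologicalType) : Prop :=
  exists2 D : set V, countable D & dense D.

Definition is_metric (R : realType) (V : Type) (d : V -> V -> R) : Prop :=
  [/\ forall x y, 0 <= d x y,
      forall x y, d x y = 0 <-> x = y,
      forall x y, d x y = d y x &
      forall x y z, d x z <= d x y + d y z].

Definition metric_compatible (R : realType) (V : topologicalType)
    (d : V -> V -> R) : Prop :=
  forall x : V,
    nbhs x = filter_from [set e : R | 0 < e] (fun e => [set y | d x y < e]).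

Definition metric_complete (R : realType) (V : topologicalType)
    (d : V -> V -> R) : Prop :=
  forall u : nat -> V,
    (forall e : R, 0 < e ->
      exists N, forall m n, (N <= m)%N -> (N <= n)%N -> d (u m) (u n) < e) ->
    exists l : V, u @ \oo --> l.

Definition polish_space (R : realType) (V : topologicalType) : Prop :=
  separable V /\
  exists d : V -> V -> R,
    [/\ is_metric d, metric_compatible d & metric_complete d].

Definition borel_set (V : topologicalType) : set (set V) := <<s @open V >>.

Definition baire_space : topologicalType := prod_topology (fun _ : nat => nat).

Definition pointclass := forall X : topologicalType, set (set X).

(* The index m is the level of the Lusin hierarchy.  Level 0 only starts the
   recursion: [Sigma1 0] is the class of open sets, so that [Sigma1 1]
   consists of the projections along Baire space of closed sets. *)
Fixpoint Sigma1 (m : nat) : pointclass := fun X A =>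
  if m is n.+1 then
    exists2 C : set (X * baire_space), Sigma1 n (~` C) & A = fst @` C
  else open A.

Definition Pi1 (m : nat) : pointclass := fun X A => Sigma1 m (~` A).

Definition Delta1 (m : nat) : pointclass := fun X A => Sigma1 m A /\ Pi1 m A.

Definition projective_pointclass (P : pointclass) : Prop :=
  exists2 m : nat, (1 <= m)%N & [\/ P = Sigma1 m, P = Pi1 m | P = Delta1 m].

Definition pointclass_function (P : pointclass) (X Y : topologicalType)
    (f : X -> Y) : Prop :=
  forall B : set Y, borel_set B -> P X (f @^-1` B).

Definition generated_graph (V : Type) (f : V -> V) : set (V * V) :=
  [set e | e.1 <> e.2 /\ (f e.1 = e.2 \/ f e.2 = e.1)].

Definition class_colouring (P : pointclass) (V : topologicalType)
    (E : set (V * V)) (K : Type) (c : V -> K) : Prop :=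
  (forall v w, E (v, w) -> c v <> c w) /\
  (forall k : K, P V (c @^-1` [set k])).

(* Cardinals are represented by types up to equipotence: K has the least
   cardinality among the types of colours of P class colourings. *)
Definition is_class_chromatic_number (P : pointclass) (V : topologicalType)
    (E : set (V * V)) (K : Type) : Prop :=
  (exists c : V -> K, class_colouring P E c) /\
  (forall L : Type, (exists c : V -> L, class_colouring P E c) ->
    [set: K] #<= [set: L]).

(* Main.v *)
(* If f v <> v implies c v <> c (f v) and c uses the colours 0, ..., m with
   m >= 3, recolour v by the colour of f v.  All preimages of v then carry the
   old colour c v, so each vertex of colour m sees at most two colours around it
   and can be moved to one of 0, 1, 2.  Hence a finite chromatic number is at
   most 3.  The new classes stay in the pointclass because finite colourings in
   the class have ambiguous (Delta) fibres and ambiguous sets are closed under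
   preimages by f, which rests on coding V by a continuous surjection from Baire
   space.  A countable colouring always exists: the colour of v is the least n
   with v in U_n and f v outside U_n, for a countable point-separating family
   of open sets U_n, so an infinite chromatic number is that of nat. *)
Require Import Defs.
From mathcomp Require Import all_boot all_order all_algebra lra.
From mathcomp Require Import all_classical all_reals all_analysis.

Set Implicit Arguments.
Unset Strict Implicit.
Unset Printing Implicit Defensive.

Import Order.TTheory GRing.Theory Num.Theory.

Local Open Scope classical_set_scope.
Local Open Scope card_scope.

(** * Closure properties of the Lusin classes *)

Lemma continuous_pair (X Y Z : topologicalType) (g : X -> Y) (h : X -> Z) :
  continuous g -> continuous h -> continuous (fun x => (g x, h x)).
Proof. by move=> cg ch x; apply: cvg_pair; [exact: cg | exact: ch]. Qed.

Lemma continuous_fst (X Y : topologicalType) : continuous (@fst X Y).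
Proof. by move=> x; exact: cvg_fst. Qed.

Lemma continuous_snd (X Y : topologicalType) : continuous (@snd X Y).
Proof. by move=> x; exact: cvg_snd. Qed.

Lemma continuous_compose (X Y Z : topologicalType) (g : Y -> Z) (h : X -> Y) :
  continuous g -> continuous h -> continuous (fun x => g (h x)).
Proof. by move=> cg ch x; apply: continuous_comp; [exact: ch | exact: cg]. Qed.

Lemma baire_coord_continuous (k : nat) :
  continuous ((fun z => z k) : baire_space -> nat).
Proof. exact: (@proj_continuous nat (fun=> nat) k). Qed.

Lemma continuous_to_baire (X : topologicalType) (g : X -> baire_space) :
  (forall k, continuous (fun x => g x k)) -> continuous g.
Proof.
move=> cg x; apply/cvg_sup => k.
exact: (@continuous_comp_initial _ _ _ (fun z : nat -> nat => z k) g (cg k) x).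
Qed.

(** A single point of Baire space stores a whole sequence of them, so countably many existential
    witnesses can be merged into one. *)
Definition baire_slice (k : nat) (z : baire_space) : baire_space :=
  fun i => z (pickle (k, i)).

Definition baire_shift (z : baire_space) : baire_space := fun i => z i.+1.

Definition baire_cons (k : nat) (z : baire_space) : baire_space :=
  fun i => if i is j.+1 then z j else k.

Lemma baire_slice_continuous k : continuous (baire_slice k).
Proof. by apply: continuous_to_baire => i; exact: baire_coord_continuous. Qed.

Lemma baire_shift_continuous : continuous baire_shift.
Proof. by apply: continuous_to_baire => i; exact: baire_coord_continuous. Qed.

Lemma baire_slice_surj (w : nat -> baire_space) :
  exists z, forall k, baire_slice k z = w k.
Proof.
exists (fun j => if unpickle j is Some p then w p.1 p.2 else 0%N) => k.
by apply: funext => i; rewrite /baire_slice pickleK.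
Qed.

Lemma image_fstE (X Y : Type) (C : set (X * Y)) :
  fst @` C = [set x | exists y, C (x, y)].
Proof.
apply/seteqP; split=> [x [[y z] Cyz <-]|x [y Cxy]]; first by exists z.
by exists (x, y).
Qed.

Lemma Sigma1_preimage n (X Y : topologicalType) (g : X -> Y) (A : set Y) :
  continuous g -> Sigma1 n A -> Sigma1 n (g @^-1` A).
Proof.
elim: n X Y g A => [|n IH] X Y g A cg /=; first by move/continuousP: cg; apply.
move=> [C hC ->]; exists ((fun x => (g x.1, x.2)) @^-1` C).
  rewrite preimage_setC; apply: IH hC; apply: continuous_pair.
    exact: continuous_compose cg (@continuous_fst _ _).
  exact: continuous_snd.
by rewrite !image_fstE.
Qed.

Lemma Pi1_succ n (X : topologicalType) (A : set X) :
  Pi1 n A -> Sigma1 n.+1 A.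
Proof.
move=> hA; exists (fst @^-1` A).
  by rewrite preimage_setC; apply: Sigma1_preimage hA; exact: continuous_fst.
rewrite image_fstE; apply/seteqP; split=> [x Ax|x [z]//].
by exists (fun=> 0%N).
Qed.

Lemma Sigma1_clopen n (X : topologicalType) (A : set X) :
  clopen A -> Sigma1 n A.
Proof.
elim: n X A => [|n IH] X A cA; first by case: cA.
by apply: Pi1_succ; apply: IH; exact: clopenC.
Qed.

(** Choice gathers one witness per index, and the slices of one point carry them all. Unions at
    level n enter as a hypothesis because this serves inside the induction of
    [Sigma1_bigcup_setI]. *)
Lemma Sigma1S_bigcap n :
  (forall (X : topologicalType) (A : nat -> set X),
    (forall k, Sigma1 n (A k)) -> Sigma1 n (\bigcup_k A k)) ->
  forall (X : topologicalType) (A : nat -> set X),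
    (forall k, Sigma1 n.+1 (A k)) -> Sigma1 n.+1 (\bigcap_k A k).
Proof.
move=> bigcupS X A hA.
have /choice[C hC] : forall k, exists C : set (X * baire_space),
    Sigma1 n (~` C) /\ A k = fst @` C.
  by move=> k; have [C] := hA k; exists C.
exists (\bigcap_k (fun x => (x.1, baire_slice k x.2)) @^-1` C k).
  rewrite setC_bigcap; apply: bigcupS => k.
  rewrite preimage_setC; apply: Sigma1_preimage (hC k).1.
  apply: continuous_pair; first exact: continuous_fst.
  apply: continuous_compose; [exact: baire_slice_continuous|].
  exact: continuous_snd.
rewrite image_fstE; apply/seteqP; split=> [x Ax|x [z Cz] k _].
  have /choice[w hw] : forall k, exists z, C k (x, z).
    by move=> k; have := Ax k I; rewrite (hC k).2 image_fstE.
  have [z hz] := baire_slice_surj w.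
  by exists z => k _ /=; rewrite hz.
by rewrite (hC k).2 image_fstE; exists (baire_slice k z); exact: Cz.
Qed.

Lemma bigcap2_nat (T : Type) (A B : set T) :
  A `&` B = \bigcap_(k : nat) (if k is 0%N then A else B).
Proof.
apply/seteqP; split=> [x [Ax Bx] [|k] _//|x ABx].
by split; [exact: (ABx 0%N I) | exact: (ABx 1%N I)].
Qed.

Lemma bigcup2_nat (T : Type) (A B : set T) :
  A `|` B = \bigcup_(k : nat) (if k is 0%N then A else B).
Proof.
apply/seteqP; split=> [x [Ax|Bx]|x [[|k] _ ?]]; last 2 first.
- by left.
- by right.
- by exists 0%N.
- by exists 1%N.
Qed.

(** Intersections one level up need only unions at level n, through [Sigma1S_bigcap]; unions one
    level up need both closures at level n. Hence the joint induction. *)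
Lemma Sigma1_bigcup_setI n :
  (forall (X : topologicalType) (A : nat -> set X),
    (forall k, Sigma1 n (A k)) -> Sigma1 n (\bigcup_k A k)) /\
  (forall (X : topologicalType) (A B : set X),
    Sigma1 n A -> Sigma1 n B -> Sigma1 n (A `&` B)).
Proof.
elim: n => [|n [bigcupS setIS]].
  split=> [X A hA|X A B]; last exact: openI.
  by apply: bigcup_open => k _; exact: hA.
split=> X A; last first.
  move=> B hA hB; rewrite bigcap2_nat.
  by apply: Sigma1S_bigcap => // -[].
move=> hA.
have /choice[C hC] : forall k, exists C : set (X * baire_space),
    Sigma1 n (~` C) /\ A k = fst @` C.
  by move=> k; have [C] := hA k; exists C.
pose t (x : X * baire_space) := (x.1, baire_shift x.2).
(* The entry at 0 names the member of the union; the shifted rest is a witness for that member. *)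
exists [set x | C (x.2 0%N) (t x)].
  rewrite (_ : ~` _ = \bigcup_k ([set x | x.2 0%N = k] `&` t @^-1` (~` C k))).
    apply: bigcupS => k; apply: setIS.
      apply: Sigma1_clopen.
      apply: (@clopen_comp _ _ (fun x : X * baire_space => x.2 0%N) [set k]).
        by split; [exact: discrete_open | exact: discrete_closed].
      apply: (@continuous_compose _ _ _ (fun z : baire_space => z 0%N)).
        exact: baire_coord_continuous.
      exact: continuous_snd.
    apply: Sigma1_preimage (hC k).1.
    apply: continuous_pair; first exact: continuous_fst.
    apply: continuous_compose; [exact: baire_shift_continuous|].
    exact: continuous_snd.
  apply/seteqP; split=> [x Cx|x [k _ [/= <-]]//].
  by exists (x.2 0%N).
rewrite image_fstE; apply/seteqP; split=> [x [k _]|x [z Cz]].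
  rewrite (hC k).2 image_fstE => -[z Cz].
  by exists (baire_cons k z).
by exists (z 0%N) => //; rewrite (hC _).2 image_fstE; exists (baire_shift z).
Qed.

Lemma Sigma1_bigcup n (X : topologicalType) (A : nat -> set X) :
  (forall k, Sigma1 n (A k)) -> Sigma1 n (\bigcup_k A k).
Proof. exact: (Sigma1_bigcup_setI n).1. Qed.

Lemma Sigma1_bigcap n (X : topologicalType) (A : nat -> set X) :
  (forall k, Sigma1 n.+1 (A k)) -> Sigma1 n.+1 (\bigcap_k A k).
Proof. by apply: Sigma1S_bigcap => Y B; exact: Sigma1_bigcup. Qed.

Lemma Sigma1_setI n (X : topologicalType) (A B : set X) :
  Sigma1 n A -> Sigma1 n B -> Sigma1 n (A `&` B).
Proof. exact: (Sigma1_bigcup_setI n).2. Qed.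

Lemma Sigma1_setU n (X : topologicalType) (A B : set X) :
  Sigma1 n A -> Sigma1 n B -> Sigma1 n (A `|` B).
Proof. by move=> hA hB; rewrite bigcup2_nat; apply: Sigma1_bigcup => -[]. Qed.

(** The projected coordinate and the witness hidden in A become slices 0 and 1 of one point. *)
Lemma Sigma1_projection n (X : topologicalType) (A : set (X * baire_space)) :
  Sigma1 n.+1 A -> Sigma1 n.+1 (fst @` A).
Proof.
move=> [C hC ->].
pose t (x : X * baire_space) :=
  ((x.1, baire_slice 0 x.2), baire_slice 1 x.2).
exists (t @^-1` C).
  rewrite preimage_setC; apply: Sigma1_preimage hC.
  have ct k : continuous (fun x : X * baire_space => baire_slice k x.2).
    apply: continuous_compose; [exact: baire_slice_continuous|].
    exact: continuous_snd.
  apply: continuous_pair; last exact: ct.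
  by apply: continuous_pair; [exact: continuous_fst | exact: ct].
rewrite !image_fstE; apply/seteqP; split=> [x [y [z Cxyz]]|x [z Cz]].
  have [w hw] := baire_slice_surj (fun k => if k is 0%N then y else z).
  by exists w; rewrite /t /preimage /= !hw.
by exists (baire_slice 0 z), (baire_slice 1 z).
Qed.

Lemma Delta1_setC n (X : topologicalType) (A : set X) :
  Delta1 n A -> Delta1 n (~` A).
Proof. by move=> [sA pA]; split=> //; rewrite /Pi1 setCK. Qed.

Lemma Delta1_bigcup n (X : topologicalType) (A : nat -> set X) :
  (forall k, Delta1 n.+1 (A k)) -> Delta1 n.+1 (\bigcup_k A k).
Proof.
move=> hA; split; first by apply: Sigma1_bigcup => k; exact: (hA k).1.
by rewrite /Pi1 setC_bigcup; apply: Sigma1_bigcap => k; exact: (hA k).2.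
Qed.

Lemma Delta1_bigcap n (X : topologicalType) (A : nat -> set X) :
  (forall k, Delta1 n.+1 (A k)) -> Delta1 n.+1 (\bigcap_k A k).
Proof.
move=> hA; rewrite -[X in Delta1 _ X]setCK setC_bigcap.
by apply/Delta1_setC/Delta1_bigcup => k; exact: Delta1_setC.
Qed.

Lemma Delta1_setI n (X : topologicalType) (A B : set X) :
  Delta1 n.+1 A -> Delta1 n.+1 B -> Delta1 n.+1 (A `&` B).
Proof. by move=> hA hB; rewrite bigcap2_nat; apply: Delta1_bigcap => -[]. Qed.

Lemma Delta1_setU n (X : topologicalType) (A B : set X) :
  Delta1 n.+1 A -> Delta1 n.+1 B -> Delta1 n.+1 (A `|` B).
Proof. by move=> hA hB; rewrite bigcup2_nat; apply: Delta1_bigcup => -[]. Qed.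

Lemma Delta1_clopen n (X : topologicalType) (A : set X) :
  clopen A -> Delta1 n A.
Proof.
by move=> cA; split; [exact: Sigma1_clopen | exact/Sigma1_clopen/clopenC].
Qed.

(** * Polish spaces *)

Lemma exists_half_expn_lt (R : realType) (e : R) :
  (0 < e)%R -> exists k, (2^-1 ^+ k < e)%R.
Proof.
move=> e0; have [N _ hN] := near_infty_natSinv_expn_lt (PosNum e0).
by exists N; have := hN N (leqnn N); rewrite /= div1r exprVn.
Qed.

Lemma half_expnS (R : realType) (k : nat) :
  (2^-1 ^+ k = 2^-1 ^+ k.+1 + 2^-1 ^+ k.+1 :> R)%R.
Proof. by rewrite exprS; lra. Qed.

Lemma half_expn_gt0 (R : realType) (k : nat) : (0 < 2^-1 ^+ k :> R)%R.
Proof. by rewrite exprn_gt0 // invr_gt0. Qed.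

Lemma metric_openP (R : realType) (V : topologicalType) (d : V -> V -> R)
    (A : set V) : metric_compatible d ->
  open A <-> forall x, A x ->
    exists2 e : R, (0 < e)%R & [set y | (d x y < e)%R] `<=` A.
Proof.
by move=> dV; rewrite openE; split=> oA x /oA; rewrite /interior /= dV.
Qed.

Lemma metric_ball_open (R : realType) (V : topologicalType) (d : V -> V -> R)
    (x : V) (r : R) :
  is_metric d -> metric_compatible d -> open [set y | (d x y < r)%R].
Proof.
move=> [_ _ _ dtri] dV; apply/metric_openP => // y /= dxy.
exists (r - d x y)%R; first by rewrite subr_gt0.
by move=> z /= dyz; have := dtri x y z; lra.
Qed.

Lemma metric_cvg (R : realType) (V : topologicalType) (d : V -> V -> R)
    (u : nat -> V) (l : V) : metric_compatible d -> u @ \oo --> l ->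
  forall e : R, (0 < e)%R ->
    exists N, forall n, (N <= n)%N -> (d l (u n) < e)%R.
Proof.
move=> dV ul e e0; have : nbhs l [set y | (d l y < e)%R] by rewrite dV; exists e.
by move=> /ul[N _ hN]; exists N.
Qed.

Lemma metric_le_half_expn_eq (R : realType) (V : Type) (d : V -> V -> R)
    (x y : V) :
  is_metric d -> (forall k, (d x y <= 2^-1 ^+ k)%R) -> x = y.
Proof.
move=> [d0 dE _ _] dxy; apply/dE/le_anti; rewrite d0 andbT leNgt.
by apply/negP => /exists_half_expn_lt[k]; rewrite ltNge dxy.
Qed.

Lemma separable_dense_sequence (V : topologicalType) :
  separable V -> [set: V] !=set0 ->
  exists q : nat -> V, forall O : set V, O !=set0 -> open O -> exists k, O (q k).
Proof.
move=> [D /countable_injP[g ginj] denseD] [x0 _].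
(* An index that [g] does not attain on D gets the default [x0]; only indices [g x] with x in D
   matter below. *)
have /choice[q hq] : forall k, exists x,
    (exists2 y, D y & g y = k) -> D x /\ g x = k.
  move=> k; have [[y Dy gy]|nk] := pselect (exists2 y, D y & g y = k).
    by exists y.
  by exists x0.
exists q => O O0 oO; have [x [Ox Dx]] := denseD O O0 oO.
have [Dq gq] : D (q (g x)) /\ g (q (g x)) = g x by apply: hq; exists x.
by exists (g x); rewrite (ginj _ _ _ _ gq) ?inE.
Qed.

Lemma polish_separating_sequence (R : realType) (V : topologicalType) :
  polish_space R V -> [set: V] !=set0 ->
  exists U : nat -> set V, (forall k, open (U k)) /\
    forall x y, x <> y -> exists k, U k x /\ ~ U k y.
Proof.
move=> [sepV [d [dM dV _]]] V0; have [q hq] := separable_dense_sequence sepV V0.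
have [d0 dE dsym dtri] := dM.
pose B (p : nat * nat) := [set y | (d (q p.1) y < 2^-1 ^+ p.2)%R].
exists (fun k => if unpickle k is Some p then B p else set0); split.
  by move=> k; case: unpickle => [p|]; [exact: metric_ball_open|exact: open0].
move=> x y xy; have dxy : (0 < d x y)%R.
  by rewrite lt_neqAle d0 andbT eq_sym; apply/eqP => /dE.
have [j hj] := exists_half_expn_lt dxy.
have [i /= hi] : exists i, [set z | (d x z < 2^-1 ^+ j.+1)%R] (q i).
  apply: hq; last exact: metric_ball_open.
  by exists x; rewrite /= (dE x x).2 // half_expn_gt0.
(* The radius is half of 2^-j, which is below [d x y], so a ball of this radius cannot contain both
   x and y. *)
exists (pickle (i, j.+1)); rewrite pickleK /B /= dsym; split=> //.
by have := dtri x (q i) y; have := half_expnS R j; lra.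
Qed.

Lemma Delta1S n (X : topologicalType) (A : set X) :
  Delta1 n A -> Delta1 n.+1 A.
Proof.
move=> [sA pA]; split; first exact: Pi1_succ.
by apply: Pi1_succ; rewrite /Pi1 setCK.
Qed.

(* Open sets of a metrizable space are F_sigma, which is what makes them
   Sigma1 1; the inclusion of Sigma1 0 in Sigma1 1 fails for general spaces. *)
Lemma Delta1_open n (R : realType) (V : topologicalType) (d : V -> V -> R)
    (U : set V) :
  is_metric d -> metric_compatible d -> open U -> Delta1 n.+1 U.
Proof.
move=> dM dV oU; elim: n => [|n]; last exact: Delta1S.
have [_ dE dsym dtri] := dM.
split; last by apply: Pi1_succ; rewrite /Pi1 setCK.
(* These are the points at distance at least 2^-k from the complement of U: closed sets that exhaust
   U. *)
pose F k := [set y | [set w | (d y w < 2^-1 ^+ k)%R] `<=` U].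
rewrite (_ : U = \bigcup_k F k).
  apply: Sigma1_bigcup => k; apply: Pi1_succ; rewrite /Pi1 /=.
  rewrite (_ : ~` F k = \bigcup_(w in ~` U) [set y | (d w y < 2^-1 ^+ k)%R]).
    by apply: bigcup_open => w _; exact: metric_ball_open.
  apply/seteqP; split=> [y|y [w Uw /= dwy] Fy]; last first.
    by apply: Uw; apply: Fy; rewrite /= dsym.
  move=> /existsNP[w /not_implyP[/= dyw Uw]].
  by exists w => //=; rewrite dsym.
apply/seteqP; split=> [x Ux|x [k _]]; last first.
  by apply; rewrite /= (dE x x).2 // half_expn_gt0.
have [e e0 eU] := (metric_openP U dV).1 oU x Ux.
have [k hk] := exists_half_expn_lt e0.
by exists k => // y /= dxy; apply: eU; exact: lt_trans hk.
Qed.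

(** * Coding a Polish space by Baire space *)

Lemma baire_nbhs_prefix (z : baire_space) (k : nat) :
  nbhs z [set z' : baire_space | forall i, (i < k)%N -> z' i = z i].
Proof.
elim: k => [|k IH]; first by apply: (@filterS _ _ _ setT) => //; exact: filterT.
have hk : nbhs z [set z' : baire_space | z' k = z k].
  exact: (@baire_coord_continuous k z [set z k] (discrete_set1 _)).
apply: filterS (filterI IH hk) => z' [h1 h2] i; rewrite ltnS leq_eqVlt.
by move=> /orP[/eqP->|/h1].
Qed.

(* The sequence z lists candidate points q (z k); a candidate too far from its
   predecessor is ignored, so that every z yields a Cauchy sequence. *)
Fixpoint polish_approx (R : realType) (V : Type) (d : V -> V -> R)
    (q : nat -> V) (z : nat -> nat) (k : nat) : V :=
  if k is j.+1 then
    let y := polish_approx d q z j in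
    if (d y (q (z k)) < 2^-1 ^+ k)%R then q (z k) else y
  else q (z 0%N).

Lemma polish_approx_prefix (R : realType) (V : Type) (d : V -> V -> R)
    (q : nat -> V) (z z' : nat -> nat) (k : nat) :
  (forall i, (i < k.+1)%N -> z' i = z i) ->
  polish_approx d q z' k = polish_approx d q z k.
Proof.
elim: k => [|k IH] zz /=; first by rewrite zz.
by rewrite IH ?zz // => i ik; apply: zz; exact: ltnW.
Qed.

(** Step i moves by less than 2^-i, and the bound is the sum of these for i from k + 1 to k + j. The
    subtracted term lets the induction on j close. *)
Lemma polish_approx_dist (R : realType) (V : Type) (d : V -> V -> R)
    (q : nat -> V) (z : nat -> nat) (k j : nat) : is_metric d ->
  (d (polish_approx d q z k) (polish_approx d q z (k + j))
     <= 2^-1 ^+ k - 2^-1 ^+ (k + j))%R.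
Proof.
move=> [d0 dE _ dtri]; elim: j => [|j IH].
  by rewrite addn0 subrr (dE _ _).2.
rewrite addnS /=; set y := polish_approx d q z (k + j) in IH *.
have h := half_expnS R (k + j); have h0 := half_expn_gt0 R (k + j).+1.
case: ifP => [hy|_]; last by lra.
by have := dtri (polish_approx d q z k) y (q (z (k + j).+1)); lra.
Qed.

Lemma polish_baire_surjection (R : realType) (V : topologicalType) :
  polish_space R V -> [set: V] !=set0 ->
  exists2 p : baire_space -> V, continuous p & forall x, exists z, p z = x.
Proof.
move=> [sepV [d [dM dV dC]]] V0; have [q hq] := separable_dense_sequence sepV V0.
have [d0 dE dsym dtri] := dM; pose a z k := polish_approx d q z k.
have a_dist z k n : (k <= n)%N -> (d (a z k) (a z n) <= 2^-1 ^+ k)%R.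
  move=> kn; have := polish_approx_dist q z k (n - k) dM; rewrite subnKC // -/(a z k).
  by have := half_expn_gt0 R n; rewrite -/(a z n); lra.
have a_cvg (z : baire_space) : exists l : V, (a z : nat -> V) @ \oo --> l.
  apply: dC => e e0; have [k hk] := exists_half_expn_lt e0.
  exists k.+1 => m n km kn; have := dtri (a z m) (a z k.+1) (a z n).
  rewrite [d (a z m) (a z k.+1)]dsym.
  have := a_dist z _ _ km; have := a_dist z _ _ kn; have := half_expnS R k; lra.
have [p hp] := @choice _ _ (fun z l => a z @ \oo --> l) a_cvg.
have p_dist z k : (d (a z k) (p z) <= 2^-1 ^+ k + 2^-1 ^+ k)%R.
  have [N hN] := metric_cvg dV (hp z) (half_expn_gt0 R k).
  have := hN _ (leq_maxl N k); have := a_dist z _ _ (leq_maxr N k).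
  set n := maxn N k; rewrite [d (p z) (a z n)]dsym.
  have := dtri (a z k) (a z n) (p z); lra.
exists p.
  move=> z W; rewrite dV => -[e /= e0 eW].
  have [k hk] := exists_half_expn_lt e0.
  (* Agreement on k + 3 entries fixes approximation k + 2, from which each limit is at most 2^-(k+1)
     away; so the limits differ by at most 2^-k. *)
  apply: filterS (baire_nbhs_prefix z k.+3) => z' zz'; apply: eW => /=.
  have := p_dist z k.+2; have := p_dist z' k.+2.
  rewrite /a (polish_approx_prefix d q zz') -/(a z k.+2) => h1 h2.
  have := dtri (p z) (a z k.+2) (p z'); rewrite [d (p z) (a z k.+2)]dsym.
  have := half_expnS R k; have := half_expnS R k.+1; lra.
(* With this precision consecutive candidates are less than 2^-(k+1) apart, the threshold at step k
   + 1, so none is ever rejected. *)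
move=> x; have /choice[z hz] : forall k, exists i, (d x (q i) < 2^-1 ^+ k.+2)%R.
  move=> k; apply: (hq [set y | (d x y < 2^-1 ^+ k.+2)%R]).
    by exists x; rewrite /= (dE x x).2 // half_expn_gt0.
  exact: metric_ball_open.
have az k : a z k = q (z k).
  rewrite /a; elim: k => //= k ->; case: ifP => // /negP[].
  have := dtri (q (z k)) x (q (z k.+1)); rewrite [d (q (z k)) x]dsym.
  have := hz k; have := hz k.+1.
  have := half_expnS R k.+1; have := half_expnS R k.+2.
  have := half_expn_gt0 R k.+3; lra.
exists z; apply/esym/(metric_le_half_expn_eq dM) => k.
have := dtri x (q (z k.+2)) (p z); have := p_dist z k.+2; rewrite az.
have := hz k.+2; have := half_expnS R k; have := half_expnS R k.+1.
have := half_expnS R k.+2; have := half_expnS R k.+3.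
have := half_expn_gt0 R k.+4; lra.
Qed.

(* With p a continuous surjection of Baire space onto V, the preimage is the
   projection of the set of pairs (x, z) such that f x = p z and A (p z). *)
Lemma Sigma1_preimage_measurable n (R : realType) (X V : topologicalType)
    (f : X -> V) (A : set V) :
  polish_space R V -> [set: V] !=set0 ->
  (forall U : set V, open U -> Delta1 n.+1 (f @^-1` U)) ->
  Sigma1 n.+1 A -> Sigma1 n.+1 (f @^-1` A).
Proof.
move=> hV V0 hf hA; have [p cp psurj] := polish_baire_surjection hV V0.
have [U [oU Usep]] := polish_separating_sequence hV V0.
have [_ [d [dM dV _]]] := hV.
have cp2 : continuous (fun x : X * baire_space => p x.2).
  by apply: continuous_compose cp _; exact: continuous_snd.
(* This codes [f x = p z] as: every [U k] containing [f x] contains [p z]. One implication suffices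
   because [Usep] separates distinct points in either order. *)
pose E := \bigcap_k
  (fst @^-1` (~` (f @^-1` U k)) `|` (fun x : X * baire_space => p x.2) @^-1` U k).
have EP x z : E (x, z) <-> f x = p z.
  split=> [Exz|fx k _]; last first.
    by have [Up|nUp] := pselect (U k (p z)); [right | left; rewrite /= fx].
  apply: contrapT => /Usep[k [Ux Uy]].
  by have [/=|/=] := Exz k I.
rewrite (_ : f @^-1` A = fst @` (E `&` (fun x => p x.2) @^-1` A)); last first.
  rewrite image_fstE; apply/seteqP; split=> [x Ax|x [z [/EP fx /= Az]]].
    have [z pz] := psurj (f x); exists z; split; first exact/EP.
    by rewrite /= pz.
  by rewrite /= fx.
apply: Sigma1_projection; apply: Sigma1_setI; last exact: Sigma1_preimage hA.
apply: Sigma1_bigcap => k; apply: Sigma1_setU.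
  apply: Sigma1_preimage; first exact: continuous_fst.
  exact: (hf (U k) (oU k)).2.
by apply: Sigma1_preimage => //; exact: (Delta1_open n dM dV (oU k)).1.
Qed.

Lemma Delta1_preimage_measurable n (R : realType) (X V : topologicalType)
    (f : X -> V) (A : set V) :
  polish_space R V -> [set: V] !=set0 ->
  (forall U : set V, open U -> Delta1 n.+1 (f @^-1` U)) ->
  Delta1 n.+1 A -> Delta1 n.+1 (f @^-1` A).
Proof.
move=> hV V0 hf [sA pA]; split.
  exact: (Sigma1_preimage_measurable hV V0 hf sA).
by rewrite /Pi1 preimage_setC; exact: (Sigma1_preimage_measurable hV V0 hf pA).
Qed.

(** * Colourings *)

Definition Delta1_fibres (n : nat) (X : topologicalType) (T : Type)
    (c : X -> T) : Prop :=
  forall t, Delta1 n.+1 (c @^-1` [set t]).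

Lemma Delta1_set0 n (X : topologicalType) : Delta1 n (set0 : set X).
Proof. by apply: Delta1_clopen; split; [exact: open0 | exact: closed0]. Qed.

Lemma Delta1_setT n (X : topologicalType) : Delta1 n (setT : set X).
Proof. by apply: Delta1_clopen; split; [exact: openT | exact: closedT]. Qed.

(** As T is countable, each fibre of the composite is a countable union of fibres of c, whatever h
    is. *)
Lemma Delta1_fibres_comp n (X : topologicalType) (T : countType) (S : Type)
    (c : X -> T) (h : T -> S) :
  Delta1_fibres n c -> Delta1_fibres n (h \o c).
Proof.
move=> hc s; pose F k := if unpickle k is Some t then
  (if `[< h t = s >] then c @^-1` [set t] else set0) else set0.
rewrite (_ : _ @^-1` _ = \bigcup_k F k).
  apply: Delta1_bigcup => k; rewrite /F; case: unpickle => [t|].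
    by case: asboolP => _; [exact: hc | exact: Delta1_set0].
  exact: Delta1_set0.
apply/seteqP; split=> [x /= hx|x [k _]].
  by exists (pickle (c x)) => //; rewrite /F pickleK asboolT.
by rewrite /F; case: unpickle => // t; case: asboolP => //= <- ->.
Qed.

Lemma Delta1_fibres_pair n (X : topologicalType) (T S : Type)
    (c : X -> T) (e : X -> S) :
  Delta1_fibres n c -> Delta1_fibres n e ->
  Delta1_fibres n (fun x => (c x, e x)).
Proof.
move=> hc he [t s].
rewrite (_ : _ @^-1` _ = c @^-1` [set t] `&` e @^-1` [set s]).
  exact: Delta1_setI.
by apply/seteqP; split=> x /= => [[-> ->]|[-> ->]].
Qed.

Lemma Delta1_fibres_asbool n (X : topologicalType) (A : set X) :
  Delta1 n.+1 A -> Delta1_fibres n (fun x => `[< A x >]).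
Proof.
move=> hA [].
  rewrite (_ : _ @^-1` _ = A) //.
  by apply/seteqP; split=> x /= /asboolP.
rewrite (_ : _ @^-1` _ = ~` A); first exact: Delta1_setC.
apply/seteqP; split=> x /=; first by move=> h /asboolP; rewrite h.
by move=> nA; exact: asboolF.
Qed.

Lemma Delta1_first_index n (X : topologicalType) (W : nat -> set X) :
  (forall k, Delta1 n.+1 (W k)) -> (forall x, exists k, W k x) ->
  exists2 c : X -> nat, Delta1_fibres n c & forall x, W (c x) x.
Proof.
move=> hW covW.
have least x : exists k, W k x /\ forall j, (j < k)%N -> ~ W j x.
  have [k Wk] := covW x.
  have exW : exists k, `[< W k x >] by exists k; apply/asboolP.
  case: (ex_minnP exW) => m /asboolP Wm hm; exists m; split=> // j jm Wj.
  by have := hm j (asboolT Wj); rewrite leqNgt jm.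
have [c hc] := choice least.
exists c => [k|x]; last exact: (hc x).1.
rewrite (_ : _ @^-1` _ =
    W k `&` \bigcap_j (if (j < k)%N then ~` W j else setT)).
  apply: Delta1_setI => //; apply: Delta1_bigcap => j.
  by case: ifP => _; [exact: Delta1_setC | exact: Delta1_setT].
apply/seteqP; split=> [x /= <-|x [Wk ltW]] /=.
  split; first exact: (hc x).1.
  by move=> j _; case: ifP => // jc; exact: (hc x).2.
case: (ltngtP (c x) k) => // [ck|kc].
  by have := ltW (c x) I; rewrite ck => /(_ (hc x).1).
by case: ((hc x).2 k kc).
Qed.

(** * Recolouring along the function *)

Definition functional_colouring (V T : Type) (f : V -> V) (c : V -> T) : Prop :=
  forall v, f v <> v -> c v <> c (f v).

(** Every edge joins some v to [f v], and fixed points carry no loop, so properness can be tested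
    along f alone. *)
Lemma generated_graph_colouringP (V T : Type) (f : V -> V) (c : V -> T) :
  (forall v w, generated_graph f (v, w) -> c v <> c w) <->
  functional_colouring f c.
Proof.
split=> [hc v fv|hc v w [/= vw [fv|fw]]].
- by apply: hc; split=> /=; [exact/nesym | left].
- by rewrite -fv; apply: hc; rewrite fv; exact/nesym.
- by apply/nesym; rewrite -fw; apply: hc; rewrite fw.
Qed.

Definition free_colour (a b : nat) : nat :=
  if (a != 0%N) && (b != 0%N) then 0%N
  else if (a != 1%N) && (b != 1%N) then 1%N else 2%N.

Lemma free_colourP (a b : nat) :
  [/\ (free_colour a b < 3)%N, free_colour a b <> a & free_colour a b <> b].
Proof. by move: a b => [|[|[|a]]] [|[|[|b]]]. Qed.

(* The image of f takes over the colours: all preimages of v under f then share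
   the colour c v.  A fixed point has no successor colour to inherit and gets
   0 or 1, whichever differs from c v. *)
Definition push_colouring (V : Type) (f : V -> V) (c : V -> nat) (v : V) : nat :=
  if `[< f v = v >] then (c v == 0%N) : nat else c (f v).

(* In the pushed colouring the neighbours of v have at most the two colours
   c v and push_colouring f c (f v), so the colour m can be dispensed with. *)
Definition reduce_colouring (V : Type) (f : V -> V) (c : V -> nat) (m : nat)
    (v : V) : nat :=
  if push_colouring f c v == m then free_colour (c v) (push_colouring f c (f v))
  else push_colouring f c v.

Lemma push_colouring_proper (V : Type) (f : V -> V) (c : V -> nat) :
  functional_colouring f c -> functional_colouring f (push_colouring f c).
Proof.
move=> hc v fv; rewrite {1}/push_colouring asboolF //.
(* Here v has colour [c (f v)]. If [f v] is fixed, its own new colour was chosen to differ from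
   that; otherwise [hc] applies at [f v]. *)
rewrite /push_colouring; case: asboolP => [_|]; last exact: hc.
by case: (c (f v)) => [|[|k]].
Qed.

(** The vertices v and [f v] are never both moved, as their pushed colours differ. A moved v avoids
    the pushed colour of [f v]; a moved [f v] avoids [c (f v)], the pushed colour of v. *)
Lemma reduce_colouring_proper (V : Type) (f : V -> V) (c : V -> nat) (m : nat) :
  (3 <= m)%N -> functional_colouring f c ->
  functional_colouring f (reduce_colouring f c m).
Proof.
move=> m3 hc v fv; have pv := push_colouring_proper hc fv.
have [_ v1 v2] := free_colourP (c v) (push_colouring f c (f v)).
have [_ w1 w2] := free_colourP (c (f v)) (push_colouring f c (f (f v))).
rewrite /reduce_colouring; case: eqP => [pm|_]; case: eqP => [pfm|_] //.
  by move: pv; rewrite pm pfm.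
by rewrite {1}/push_colouring asboolF //; exact/nesym.
Qed.

Lemma reduce_colouring_lt (V : Type) (f : V -> V) (c : V -> nat) (m : nat) :
  (3 <= m)%N -> (forall v, (c v < m.+1)%N) ->
  forall v, (reduce_colouring f c m v < m)%N.
Proof.
move=> m3 hc v; rewrite /reduce_colouring; case: eqP => [_|pm].
  by apply: leq_trans m3; case: (free_colourP (c v) (push_colouring f c (f v))).
rewrite ltn_neqAle; apply/andP; split; first exact/eqP.
rewrite /push_colouring; case: ifP => _; last exact: hc.
by apply: leq_trans m3; case: eqP.
Qed.

(** The new colour is a function of a tuple of countably valued data with ambiguous fibres, so
    [Delta1_fibres_comp] applies. *)
Lemma reduce_colouring_fibres n (V : topologicalType) (f : V -> V)
    (c : V -> nat) (m : nat) :
  (forall A, Delta1 n.+1 A -> Delta1 n.+1 (f @^-1` A)) ->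
  Delta1 n.+1 [set v | f v = v] ->
  Delta1_fibres n c -> Delta1_fibres n (reduce_colouring f c m).
Proof.
move=> hf hfix hc.
have hcomp (e : V -> nat) : Delta1_fibres n e -> Delta1_fibres n (e \o f).
  by move=> he t; exact: (hf (e @^-1` [set t]) (he t)).
have hpush : Delta1_fibres n (push_colouring f c).
  have h := Delta1_fibres_pair (Delta1_fibres_asbool hfix)
    (Delta1_fibres_pair hc (hcomp c hc)).
  exact: (Delta1_fibres_comp (fun p : bool * (nat * nat) =>
    if p.1 then (p.2.1 == 0%N) : nat else p.2.2) h).
have h := Delta1_fibres_pair hpush (Delta1_fibres_pair hc (hcomp _ hpush)).
exact: (Delta1_fibres_comp (fun p : nat * (nat * nat) =>
  if p.1 == m then free_colour p.2.1 p.2.2 else p.1) h).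
Qed.

(** These three properties are the interface through which the sigma, pi and delta cases are treated
    at once. *)
Lemma projective_pointclassP (P : pointclass) :
  projective_pointclass P -> exists n,
    [/\ forall (X : topologicalType) (A : set X), Delta1 n.+1 A -> P X A,
        forall (X : topologicalType) (A : set X),
          P X A -> P X (~` A) -> Delta1 n.+1 A &
        forall (X : topologicalType) (A : nat -> set X),
          (forall k, P X (A k)) -> P X (\bigcup_k A k)].
Proof.
move=> [[//|n] _ hP]; exists n; case: hP => ->; split.
- by move=> X A [].
- by move=> X A.
- by move=> X A; exact: Sigma1_bigcup.
- by move=> X A [].
- by move=> X A hA hA'; split=> //; move: hA'; rewrite /Pi1 setCK.
- by move=> X A hA; rewrite /Pi1 setC_bigcup; exact: Sigma1_bigcap.
- by [].
- by [].
- by move=> X A; exact: Delta1_bigcup.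
Qed.

(** * Countable colourings and the dichotomy *)

Lemma open_borel_set (V : topologicalType) (U : set V) : open U -> borel_set U.
Proof. by move=> oU S [_]; exact. Qed.

Lemma borel_setC (V : topologicalType) (A : set V) :
  borel_set A -> borel_set (~` A).
Proof.
move=> bA S hS; have SA := bA S hS; case: hS => -[_ SC _] _.
by rewrite -setTD; exact: SC.
Qed.

(** Borel sets are closed under complement, so such a preimage lies in P together with its
    complement, even when P is not self-dual. *)
Lemma pointclass_function_Delta1 (P : pointclass) n (X Y : topologicalType)
    (f : X -> Y) (U : set Y) :
  (forall (Z : topologicalType) (A : set Z),
    P Z A -> P Z (~` A) -> Delta1 n A) ->
  pointclass_function P f -> open U -> Delta1 n (f @^-1` U).
Proof.
move=> hP hf /open_borel_set bU; apply: hP; first exact: hf.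
by rewrite preimage_setC; apply: hf; exact: borel_setC.
Qed.

Lemma Delta1_fixed_points n (R : realType) (V : topologicalType) (f : V -> V) :
  polish_space R V -> [set: V] !=set0 ->
  (forall U : set V, open U -> Delta1 n.+1 (f @^-1` U)) ->
  Delta1 n.+1 [set v | f v = v].
Proof.
move=> hV V0 hf; have [U [oU Usep]] := polish_separating_sequence hV V0.
have [_ [d [dM dV _]]] := hV.
rewrite (_ : [set v | _] = \bigcap_k (~` U k `|` f @^-1` U k)).
  apply: Delta1_bigcap => k; apply: Delta1_setU; last exact: hf.
  by apply: Delta1_setC; exact: (Delta1_open n dM dV (oU k)).
apply/seteqP; split=> [v /= fv k _|v hv].
  by have [Uv|] := pselect (U k v); [right; rewrite /= fv | left].
apply: contrapT => /nesym/Usep[k [Uv nUfv]].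
by have [|] := hv k I.
Qed.

Lemma countable_Delta1_colouring n (R : realType) (V : topologicalType)
    (f : V -> V) :
  polish_space R V -> [set: V] !=set0 ->
  (forall U : set V, open U -> Delta1 n.+1 (f @^-1` U)) ->
  exists2 c : V -> nat, Delta1_fibres n c & functional_colouring f c.
Proof.
move=> hV V0 hf; have [U [oU Usep]] := polish_separating_sequence hV V0.
have [_ [d [dM dV _]]] := hV.
(* Index 0 is reserved for fixed points, which no [U j] can separate from their image. *)
pose W k := if k is j.+1 then U j `&` ~` (f @^-1` U j) else [set v | f v = v].
have [||c hc Wc] := @Delta1_first_index n V W.
- case=> [|k]; first exact: Delta1_fixed_points hV V0 hf.
  apply: Delta1_setI; first exact: (Delta1_open n dM dV (oU k)).
  by apply: Delta1_setC; exact: hf.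
- move=> v; have [fv|/nesym/Usep[k hk]] := pselect (f v = v); first by exists 0%N.
  by exists k.+1.
exists c => // v fv cE; have := Wc v; have := Wc (f v); rewrite -cE.
by case: (c v) => [|k] /=; [move=> _ /fv | move=> [Ufv _] [_]].
Qed.

(** The complement of a colour class is the countable union of the other classes, hence again in
    P. *)
Lemma colouring_Delta1_fibres (P : pointclass) n (V : topologicalType)
    (E : set (V * V)) (c : V -> nat) :
  (forall (X : topologicalType) (A : set X),
    P X A -> P X (~` A) -> Delta1 n.+1 A) ->
  (forall (X : topologicalType) (A : nat -> set X),
    (forall k, P X (A k)) -> P X (\bigcup_k A k)) ->
  (forall X : topologicalType, P X set0) ->
  class_colouring P E c -> Delta1_fibres n c.
Proof.
move=> PD Pcup P0 [_ hc] k; apply: PD; first exact: hc.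
rewrite (_ : ~` _ = \bigcup_j (if j == k then set0 else c @^-1` [set j])).
  by apply: Pcup => j; case: eqP.
apply/seteqP; split=> [v /= cv|v [j _]]; first by exists (c v) => //; case: eqP.
by case: eqP => //= jk -> /jk.
Qed.

Lemma finite_palette_nat_colouring (P : pointclass) (V : topologicalType)
    (E : set (V * V)) (L : Type) (c : V -> L) (k : nat) :
  P V set0 -> class_colouring P E c -> [set: L] #= `I_k ->
  exists e : V -> nat, class_colouring P E e /\ forall v, (e v < k)%N.
Proof.
move=> P0 [cE cP] /card_set_bijP[g [gk ginj _]].
exists (g \o c); split=> [|v]; last exact: gk.
split=> [v w /cE cvw|j].
  by move=> /ginj cvw'; apply: cvw; apply: cvw'; rewrite inE.
have [[l gl]|nl] := pselect (exists l, g l = j).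
  rewrite (_ : _ @^-1` _ = c @^-1` [set l]) //.
  apply/seteqP; split=> v /= => [gv|->//].
  by apply: ginj; rewrite ?inE // gl.
(* A number that [g] does not attain has an empty colour class. *)
rewrite (_ : _ @^-1` _ = set0) //.
by apply/seteqP; split=> v //= gv; apply: nl; exists (c v).
Qed.

Theorem theorem3p12 (R : realType) (P : pointclass)
    (hP : projective_pointclass P)
    (V : topologicalType) (hV : polish_space R V) (hV0 : [set: V] !=set0)
    (f : V -> V) (hf : pointclass_function P f) :
  exists K : Type,
    is_class_chromatic_number P (generated_graph f) K /\
    ((([set: K] #= `I_1) \/ ([set: K] #= `I_2) \/ ([set: K] #= `I_3)) \/
     infinite_set [set: K]).
Proof.
have [n [DP PD Pcup]] := projective_pointclassP hP.
have P0 (X : topologicalType) : P X set0 by exact/DP/Delta1_set0.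
have hfo (U : set V) : open U -> Delta1 n.+1 (f @^-1` U).
  exact: pointclass_function_Delta1 hf.
have hfD (A : set V) : Delta1 n.+1 A -> Delta1 n.+1 (f @^-1` A).
  exact: Delta1_preimage_measurable hV hV0 hfo.
have hfix := Delta1_fixed_points hV hV0 hfo.
pose bounded k := exists c : V -> nat,
  class_colouring P (generated_graph f) c /\ forall v, (c v < k)%N.
have [exk|nok] := pselect (exists k, bounded k); last first.
  exists nat; split; last by right; exact: infinite_nat.
  split=> [|L [c hc]].
    have [c hc fc] := countable_Delta1_colouring hV hV0 hfo.
    by exists c; split=> [|k]; [exact/generated_graph_colouringP | exact/DP/hc].
  (* A finite palette could be renamed to an initial segment of the naturals, contradicting
     [nok]. *)
  apply/infiniteP => /finite_setP[k Lk]; apply: nok; exists k.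
  exact: finite_palette_nat_colouring hc Lk.
have exb : exists k, `[< bounded k >] by have [k bk] := exk; exists k; exact/asboolP.
case: (ex_minnP exb) => k /asboolP[c [hc ck]] kmin.
have le_k j : bounded j -> (k <= j)%N by move=> /asboolP/kmin.
have k_gt0 : (0 < k)%N by have [v _] := hV0; exact: leq_ltn_trans (ck v).
have k_le3 : (k <= 3)%N.
  case: k => [|m] // in c hc ck le_k k_gt0 kmin *; rewrite ltnNge; apply/negP => m3.
  have hcD := colouring_Delta1_fibres PD Pcup P0 hc.
  have: bounded m.
    exists (reduce_colouring f c m); split; last exact: reduce_colouring_lt.
    split=> [|j]; last by apply: DP; exact: reduce_colouring_fibres.
    apply/generated_graph_colouringP/reduce_colouring_proper => //.
    by apply/generated_graph_colouringP; case: hc.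
  by move=> /le_k; rewrite ltnn.
exists 'I_k; split; last first.
  left; have := card_II (n := k); rewrite card_eq_sym.
  by case: k k_gt0 k_le3 {c hc ck kmin le_k} => [|[|[|[|k]]]] //; auto.
split=> [|L [e he]].
  exists (fun v => Ordinal (ck v)); case: hc => cE cP; split=> [v w /cE cvw [] //|i].
  rewrite (_ : _ @^-1` _ = c @^-1` [set val i]) //.
  by apply/seteqP; split=> v /= => [<-|cv] //; exact/val_inj.
rewrite -(card_le_eql card_II).
(* A finite L has at least k elements by minimality of k; an infinite one contains a copy of the
   naturals. *)
have [/finite_setP[j Lj]|/infiniteP natL] := pselect (finite_set [set: L]).
  rewrite (card_le_eqr Lj) card_le_II; apply: le_k.
  exact: finite_palette_nat_colouring he Lj.
exact: card_le_trans (card_leT _) natL.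
Qed.
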